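(* Let $n\ge 1$ be an integer and let $\zeta_n$ be any primitive $n$-th root of unity. For all integers $k,r\ge 1$ we have $z_n(\{k\}^r;\zeta_n)\in(1-\zeta_n)^{kr}\mathbb{Q}$, and in particular \begin{align*} z_n(\{1\}^r;\zeta_n)&=\frac{1}{n}\binom{n}{r+1}(1-\zeta_n)^{r},\\ z_n(\{2\}^r;\zeta_n)&=\frac{(-1)^r}{n\,(r+1)}\binom{n+r}{2r+1}(1-\zeta_n)^{2r},\\ z_n(\{3\}^r;\zeta_n)&=\frac{1}{n^2(r+1)}\left(\binom{n+2r+1}{3r+2}+(-1)^r\binom{n+r}{3r+2}\right)(1-\zeta_n)^{3r}. \end{align*}
   Context: For an index $\mathbf{k}=(k_1,\dots,k_r)\in(\mathbb{Z}_{\ge1})^r$, an integer $n\ge1$ and a complex number $q$ with $q^m\neq1$ for $0<m<n$, the finite multiple harmonic $q$-series is $$z_n(\mathbf{k};q)=\sum_{n>m_1>\dots>m_r>0}\frac{q^{(k_1-1)m_1}\cdots q^{(k_r-1)m_r}}{[m_1]_q^{k_1}\cdots[m_r]_q^{k_r}},\qquad [m]_q=\frac{1-q^m}{1-q}.$$ $\{k\}^r$ denotes the index $(k,\dots,k)$ with $r$ entries. Binomial coefficients $\binom{a}{b}$ with $b>a\ge 0$ are $0$. *)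

(* Defs.v *)
From mathcomp Require Import all_boot all_order all_algebra.
From mathcomp Require Import reals complex.

Set Implicit Arguments.
Unset Strict Implicit.
Unset Printing Implicit Defensive.

Import Order.TTheory GRing.Theory Num.Theory.
Local Open Scope ring_scope.

Definition qint (F : fieldType) (q : F) (m : nat) : F := (1 - q ^+ m) / (1 - q).

(* The position of an entry in the index is shifted: tnth k i and m i stand for
   k_(i+1) and m_(i+1). The values m i : 'I_n are bounded by n through their
   type, so the filter only has to require positivity and strict decrease. *)
Definition zq (F : fieldType) (n r : nat) (k : r.-tuple nat) (q : F) : F :=
  \sum_(m : {ffun 'I_r -> 'I_n} |
          [forall i, (0 < m i)%N] &&
          [forall i : 'I_r, forall j : 'I_r, (i < j)%N ==> (m j < m i)%N])
    \prod_(i < r)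
      (q ^+ ((tnth k i - 1) * m i) / qint q (m i) ^+ tnth k i).

(* Main.v *)
(* Put u = zeta^m. Then z_n({k}^r; zeta) is (1 - zeta)^(k r) times the r-th
   elementary symmetric function of the numbers u^(k-1) / (1 - u)^k, u <> 1,
   i.e. a coefficient of the product of (1 - u)^k + u^(k-1) X over all n-th roots
   of unity u; the factor u = 1 is X, and the others have denominators of
   product n^k. This product is the determinant of (1 - S)^k + X S^(k-1) for the
   cyclic shift S, which the Vandermonde matrix diagonalises, so it has rational
   coefficients. For k <= 3 and X = t, the polynomial (1 - u)^k + u^(k-1) t factors
   as (a - u)(b - u)... and the product becomes (a^n - 1)(b^n - 1)..., a
   combination of power sums. Each power sum satisfies a recurrence
   (E - 1)^k f = +- t E^s f in n (E the shift n -> n + 1), and so do explicit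
   polynomials in t with binomial coefficients, by Pascal's rule. *)
Require Import Defs.
From mathcomp Require Import all_boot all_order all_algebra.
From mathcomp Require Import reals complex.
From mathcomp Require Import ring zify.

Set Implicit Arguments.
Unset Strict Implicit.
Unset Printing Implicit Defensive.

Import Order.TTheory GRing.Theory Num.Theory.
Local Open Scope ring_scope.

(** * Elementary symmetric functions and decreasing index sequences *)

Lemma coef_prod_1DZX (R : comNzRingType) (n r : nat) (x : 'I_n -> R) :
  (\prod_i (1 + x i *: 'X))`_r
    = \sum_(A : {set 'I_n} | #|A| == r) \prod_(i in A) x i.
Proof.
under eq_bigr do rewrite addrC.
rewrite bigA_distr coef_sum [RHS]big_mkcond /=; apply: eq_bigr => A _.
rewrite -(big_mkcond (mem A) (fun i => x i *: 'X)) /= scaler_prod prodr_const.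
by rewrite coefZ coefXn eq_sym; case: eqP => _; rewrite ?mulr1 ?mulr0.
Qed.

(** A strictly decreasing sequence of length [r] is determined by its image, an [r]-element subset,
    listed in decreasing order. The bound [n.+1] makes [ord0] available as a default for [nth]. *)
Lemma sum_decreasing_ffun (R : comNzRingType) (n r : nat) (x : 'I_n.+1 -> R) :
  \sum_(m : {ffun 'I_r -> 'I_n.+1} |
      [forall i : 'I_r, forall j : 'I_r, (i < j)%N ==> (m j < m i)%N])
     \prod_i x (m i)
    = \sum_(A : {set 'I_n.+1} | #|A| == r) \prod_(i in A) x i.
Proof.
pose gtv (i j : 'I_n.+1) := (j < i)%N.
have gtv_tr : transitive gtv by move=> a b c; rewrite /gtv => ? ?; lia.
have gtv_irr : irreflexive gtv by move=> a; rewrite /gtv ltnn.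
pose dec (A : {set 'I_n.+1}) : {ffun 'I_r -> 'I_n.+1} :=
  [ffun i => nth ord0 (rev (enum A)) (val i)].
have sorted_rev (A : {set 'I_n.+1}) : sorted gtv (rev (enum A)).
  rewrite rev_sorted /=.
  apply: (@subseq_sorted _ (relpre val ltn) _ _ (enum 'I_n.+1)).
  - by move=> a b c; exact: ltn_trans.
  - by rewrite enumT; exact: filter_subseq.
  - by rewrite -sorted_map val_enum_ord iota_ltn_sorted.
(* Two lists sorted by an irreflexive transitive relation are equal once they have the same members,
   so a decreasing map is recovered from its image. *)
have dec_codom (f : {ffun 'I_r -> 'I_n.+1}) :
    [forall i : 'I_r, forall j : 'I_r, (i < j)%N ==> (f j < f i)%N] ->
    rev (enum (f @: setT)) = [seq f i | i <- enum 'I_r].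
  move=> fP; apply: (irr_sorted_eq gtv_tr gtv_irr) => //.
    rewrite sorted_map (@sub_sorted _ (relpre val ltn)) //.
      by move=> i j ij; move/forallP: fP => /(_ i)/forallP/(_ j)/implyP; apply.
    by rewrite -sorted_map val_enum_ord iota_ltn_sorted.
  move=> y; rewrite mem_rev mem_enum.
  apply/imsetP/mapP => [[i _ ->]|[i _ ->]]; exists i => //.
  by rewrite mem_enum.
rewrite (reindex_onto dec (fun f => f @: setT)) /=; last first.
  move=> f fP; apply/ffunP => i; rewrite ffunE dec_codom //.
  rewrite (nth_map i) ?size_enum_ord //=.
  by rewrite nth_ord_enum.
(* Subsets of any other size drop out: if [dec A] is decreasing with image [A], then [dec_codom]
   forces [enum A] to have length [r]. *)
have decE (A : {set 'I_n.+1}) :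
    [forall i : 'I_r, forall j : 'I_r, (i < j)%N ==> (dec A j < dec A i)%N]
      && (dec A @: setT == A) = (#|A| == r).
  apply/andP/eqP => [[decP /eqP decA]|cA].
    have := congr1 size (dec_codom _ decP).
    by rewrite decA size_rev -cardE size_map size_enum_ord.
  have sz : size (rev (enum A)) = r by rewrite size_rev -cardE.
  split.
    apply/forallP => i; apply/forallP => j; apply/implyP => ij; rewrite !ffunE.
    by apply: (sorted_ltn_nth gtv_tr ord0 (sorted_rev A))  => //;
      rewrite inE sz ltn_ord.
  apply/eqP/setP => y; apply/imsetP/idP => [[i _ ->]|yA].
    by rewrite ffunE -mem_enum -mem_rev mem_nth ?sz ?ltn_ord.
  have yr : y \in rev (enum A) by rewrite mem_rev mem_enum.
  have yi : (index y (rev (enum A)) < r)%N by rewrite -sz index_mem.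
  by exists (Ordinal yi) => //; rewrite ffunE nth_index.
apply: eq_big => [A|A]; first exact: decE.
rewrite decE => /eqP cA.
have pA : perm_eq (rev (enum A)) (enum A) by rewrite perm_rev.
rewrite -[RHS]big_enum -(perm_big _ pA) /=.
rewrite (big_nth ord0) size_rev -cardE cA big_mkord.
by apply: eq_bigr => i _; rewrite ffunE.
Qed.

(** Each of the [r] entries releases a factor [(1 - q) ^+ k] from its [q]-integer; an elementary
    symmetric function remains. *)
Lemma zq_coef_prod (F : fieldType) (n r k : nat) (q : F) : (0 < k)%N ->
  zq n.+1 (nseq_tuple r k) q
    = (1 - q) ^+ (k * r)
      * (\prod_(i < n.+1)
          (1 + (q ^+ ((k - 1) * i) / (1 - q ^+ i) ^+ k) *: 'X))`_r.
Proof.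
move=> k_gt0.
pose y (i : 'I_n.+1) := q ^+ ((k - 1) * i) / (1 - q ^+ i) ^+ k.
pose x i := (1 - q) ^+ k * y i.
(* Since x / 0 = 0, a summand in which some m_i is 0 vanishes by itself, and the
   positivity constraint of [zq] can be dropped. *)
have x0 : x ord0 = 0.
  by rewrite /x /y expr0 subrr expr0n eqn0Ngt k_gt0 invr0 !mulr0.
rewrite (coef_prod_1DZX r y) -sum_decreasing_ffun /zq exprM mulr_sumr.
rewrite big_mkcond [RHS]big_mkcond /=; apply: eq_bigr => f _.
have -> : (1 - q) ^+ k ^+ r * \prod_i y (f i) = \prod_i x (f i).
  by rewrite [RHS]big_split /= prodr_const card_ord.
case: (boolP [forall i : 'I_r, (0 < f i)%N]) => [_|pos] /=.
  case: ifP => // _; apply: eq_bigr => i _; rewrite (tnth_nth 0%N) nth_nseq ltn_ord.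
  by rewrite /x /y /qint expr_div_n invf_div mulrCA.
have [i fi0] : exists i, ~~ (0 < f i)%N by apply/existsP; rewrite -negb_forall.
move: fi0; rewrite -eqn0Ngt => /eqP fi0; rewrite [in RHS](bigD1 i) //=.
by rewrite (_ : f i = ord0) ?x0 ?mul0r ?if_same //; apply: val_inj.
Qed.

(** * Products over the roots of unity *)

Lemma prod_prim_root_sub (F : fieldType) (n : nat) (z a : F) :
  n.-primitive_root z -> \prod_(i < n) (a - z ^+ i) = a ^+ n - 1.
Proof.
move=> zP; have := congr1 (horner^~ a) (factor_Xn_sub_1 zP).
rewrite horner_prod big_mkord !hornerE => <-.
by apply: eq_bigr => i _; rewrite !hornerE.
Qed.

(** Cancelling [X - 1] in the factorisation of [X^(n+1) - 1] leaves [1 + X + ... + X^n], whose value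
    at [1] is [n + 1]. *)
Lemma prod_1_sub_prim_root (F : fieldType) (n : nat) (z : F) :
  n.+1.-primitive_root z -> \prod_(i < n) (1 - z ^+ i.+1) = n.+1%:R.
Proof.
move=> zP; have := factor_Xn_sub_1 zP; rewrite big_mkord big_ord_recl expr0 subrX1.
move/(mulfI (monic_neq0 (monicXsubC 1)))/(congr1 (horner^~ 1)).
rewrite horner_prod horner_sum.
under eq_bigr do rewrite !hornerE.
move=> ->; under eq_bigr do rewrite hornerXn expr1n.
by rewrite sumr_const card_ord.
Qed.

Definition root_norm (F : fieldType) (n k : nat) (z : F) : {poly F} :=
  \prod_(i < n) (((1 - z ^+ i) ^+ k)%:P + z ^+ ((k - 1) * i) *: 'X).

(** The factor at [i = 0] is [X], which moves the coefficient from [r] to [r.+1]. Clearing the other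
    denominators costs the [k]-th power of the product [n.+1]. *)
Lemma zq_root_norm (F : fieldType) (n r k : nat) (z : F) :
  (0 < k)%N -> n.+1.-primitive_root z -> n.+1%:R != 0 :> F ->
  zq n.+1 (nseq_tuple r k) z
    = (root_norm n.+1 k z)`_r.+1 / n.+1%:R ^+ k * (1 - z) ^+ (k * r).
Proof.
move=> k_gt0 zP n_neq0; rewrite zq_coef_prod // mulrC; congr (_ * _).
rewrite /root_norm !big_ord_recl /= muln0 expr0 subrr expr0n eqn0Ngt k_gt0.
rewrite invr0 mulr0 scale0r addr0 mul1r add0r scale1r coefXM /=.
apply: (canRL (mulfK (expf_neq0 k n_neq0))).
rewrite -(prod_1_sub_prim_root zP) -prodrXl mulrC -coefCM rmorph_prod.
congr ((polyseq _)`_ _); rewrite -big_split; apply: eq_bigr => i _ /=.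
have nz : 1 - z ^+ i.+1 != 0.
  rewrite subr_eq0 -(expr0 z) (eq_prim_root_expr zP) mod0n eq_sym.
  by rewrite modn_small ?ltnS // ltn_ord.
rewrite /bump /= add1n mulrDr mulr1 mul_polyC scalerA mulrCA divff ?mulr1 //.
by rewrite expf_neq0.
Qed.

(** * Rationality through the cyclic shift matrix *)

(** Column [j] of the Vandermonde matrix is an eigenvector of the shift with eigenvalue [z ^+ j];
    the wrap-around in the last row is where [z ^+ n = 1] enters. *)
Lemma cyclic_shift_mulmx_Vandermonde (F : comNzRingType) (n : nat) (z : F) :
  z ^+ n = 1 ->
  (\matrix_(i < n, j < n) (j == ordS i)%:R)
     *m Vandermonde n (\row_(j < n) z ^+ j)
  = Vandermonde n (\row_(j < n) z ^+ j) *m diag_mx (\row_(j < n) z ^+ j).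
Proof.
move=> zn1; apply/matrixP => i j; rewrite mul_mx_diag !mxE.
rewrite (bigD1 (ordS i)) //= big1 => [|l /negPf lP]; last by rewrite !mxE lP mul0r.
rewrite !mxE eqxx mul1r addr0 -exprSr -!exprM -[RHS](expr_mod _ zn1).
rewrite -(expr_mod (j * _) zn1); congr (z ^+ _).
by rewrite modnMmr.
Qed.

Lemma root_norm_rat (F : numFieldType) (n k : nat) (z : F) :
  n.+1.-primitive_root z ->
  exists p : {poly rat}, root_norm n.+1 k z = map_poly ratr p.
Proof.
(* [S] and [H] take the ring as a parameter, so that one formula is read over [{poly rat}] and over
   [{poly F}]. *)
move=> zP; pose S (R : nzRingType) : 'M[R]_n.+1 := \matrix_(i, j) (j == ordS i)%:R.
pose H (R : comNzRingType) (x : R) := (1 - S R) ^+ k + x *: S R ^+ (k - 1).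
exists (\det (H _ 'X)).
pose f : {rmorphism {poly rat} -> {poly F}} := map_poly ratr.
rewrite -[map_poly _ _]/(f _) -det_map_mx.
have -> : map_mx f (H _ 'X) = H _ 'X.
  rewrite /H map_mxD map_mxZ /= map_polyX !rmorphXn /= rmorphB rmorph1 /=.
  rewrite (_ : map_mx f (S _) = S _) //.
  by apply/matrixP => i j; rewrite !mxE rmorph_nat.
pose d : 'rV[{poly F}]_n.+1 := \row_j (z%:P ^+ j).
pose V := Vandermonde n.+1 d.
have SV : S _ *m V = V *m diag_mx d.
  apply: cyclic_shift_mulmx_Vandermonde.
  by rewrite -polyC_exp prim_expr_order.
pose e : 'rV[{poly F}]_n.+1 :=
  \row_i (((1 - z ^+ i) ^+ k)%:P + z ^+ ((k - 1) * i) *: 'X).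
have HV : H _ 'X *m V = V *m diag_mx e.
  have pow m : S {poly F} ^+ m *m V = V *m diag_mx d ^+ m.
    elim: m => [|m IH]; first by rewrite !expr0 mulmx1 mul1mx.
    by rewrite !exprS -!mulmxE -mulmxA IH !mulmxA SV.
  have pow1 m : (1 - S {poly F}) ^+ m *m V = V *m (1 - diag_mx d) ^+ m.
    elim: m => [|m IH]; first by rewrite !expr0 mulmx1 mul1mx.
    rewrite !exprS -!mulmxE -mulmxA IH !mulmxA; congr (_ *m _).
    by rewrite mulmxBl mulmxBr SV mulmx1 mul1mx.
  have diag_exp (u : 'rV[{poly F}]_n.+1) m :
      diag_mx u ^+ m = diag_mx (\row_j (u 0 j) ^+ m).
    elim: m => [|m IH].
      by apply/matrixP => i j; rewrite !mxE expr0.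
    by rewrite exprS IH -mulmxE mulmx_diag; congr diag_mx;
      apply/rowP => j; rewrite !mxE exprS.
  have -> : diag_mx e = (1 - diag_mx d) ^+ k + 'X *: diag_mx d ^+ (k - 1).
    have -> : 1 - diag_mx d = diag_mx (\row_j (1 - d 0 j)).
      apply/matrixP => i j; rewrite !mxE.
      by case: (i == j); rewrite ?mulr1n ?mulr0n ?subr0.
    rewrite !diag_exp; apply/matrixP => i j; rewrite !mxE.
    case: (i == j); last by rewrite !mulr0n mulr0 addr0.
    rewrite !mulr1n rmorphXn rmorphB /= !polyC_exp polyC1 -!exprM mulnC.
    by rewrite -mul_polyC polyC_exp mulrC.
  by rewrite /H mulmxDl mulmxDr pow1 -scalemxAl -scalemxAr pow.
(* The nodes are distinct because [z] is primitive, so [\det V] cancels when determinants are taken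
   in [HV]. *)
have detV : \det V != 0.
  rewrite det_Vandermonde; apply/prodf_neq0 => i _; apply/prodf_neq0 => j ij.
  rewrite !mxE subr_eq0 -!polyC_exp (inj_eq (@polyC_inj _)).
  by rewrite (eq_prim_root_expr zP) !modn_small ?ltn_ord // gtn_eqF.
have := congr1 determinant HV; rewrite !det_mulmx det_diag mulrC => /(mulfI detV) ->.
by apply: eq_bigr => i _; rewrite mxE.
Qed.

(** * Power sums of roots and binomial polynomials *)

(** In characteristic 0 the natural numbers supply enough roots of [p - q]. This allows [t] to be a
    fixed scalar below, so that roots [a], [b], [c] depending on [t] exist in the field. *)
Lemma eq_poly_horner (F : numFieldType) (p q : {poly F}) :
  (forall t, p.[t] = q.[t]) -> p = q.
Proof.
move=> pq; apply/eqP; rewrite -subr_eq0; apply/eqP.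
pose rs := [seq i%:R : F | i <- iota 0 (size (p - q))].
apply: (@roots_geq_poly_eq0 _ _ rs); last by rewrite size_map size_iota.
  by apply/allP => x _; rewrite rootE hornerD hornerN pq subrr.
rewrite map_inj_uniq ?iota_uniq // => i j /eqP.
by rewrite eqr_nat => /eqP.
Qed.

Lemma coef_comp_polyN (R : comNzRingType) (p : {poly R}) (j : nat) :
  (p \Po - 'X)`_j = (-1) ^+ j * p`_j.
Proof.
rewrite comp_polyE coef_sum.
under eq_bigr => i _ 
  do rewrite exprNn -polyC1 -polyCN -polyC_exp mul_polyC scalerA coefZ coefXn.
have [jp|jp] := ltnP j (size p); last first.
  rewrite nth_default // mulr0 big1 // => i _.
  by rewrite gtn_eqF ?mulr0 // (leq_trans (ltn_ord i)).
rewrite (bigD1 (Ordinal jp)) //= eqxx mulr1 mulrC big1 ?addr0 // => i ij.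
by rewrite eq_sym (_ : (_ == _ :> nat) = false) ?mulr0 //; exact: negPf ij.
Qed.

Lemma closed_quadratic (F : closedFieldType) (s p : F) :
  exists a b, a + b = s /\ a * b = p.
Proof.
have [a aP] := @solve_monicpoly F 2 (fun i => if i == 0%N then - p else s) isT.
exists a, (s - a); split; first by ring.
move: aP; rewrite !big_ord_recl big_ord0 /= addr0 expr0 expr1 => aP.
by rewrite mulrBr -expr2 aP; ring.
Qed.

(** Given one root [c] of [x^3 - s x^2 + e x - p], the other two have sum [s - c] and product
    [e - c (s - c)]. *)
Lemma closed_cubic (F : closedFieldType) (s e p : F) :
  exists a b c, [/\ a + b + c = s, a * b + b * c + a * c = e & a * b * c = p].
Proof.
have [c] := @solve_monicpoly F 3
  (fun i => if i == 0%N then p else if i == 1%N then - e else s) isT.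
rewrite !big_ord_recl big_ord0 /= addr0 expr0 expr1 => cP.
have [a [b [ab_s ab_p]]] := closed_quadratic (s - c) (e - c * (s - c)).
exists a, b, c; split; first by rewrite ab_s subrK.
  rewrite (_ : a * b + b * c + a * c = a * b + c * (a + b)); last by ring.
  by rewrite ab_s ab_p; ring.
rewrite ab_p (_ : _ * c = e * c - s * c ^+ 2 + c ^+ 3); last by ring.
by rewrite cP /bump /=; ring.
Qed.

(* The coefficients are chosen so that their k-th difference in n is the previous
   coefficient at n + s; v and w are fitted to the initial values of the power
   sums. *)
Definition binpoly (F : nzRingType) (s k v w n : nat) : {poly F} :=
  \poly_(j < n.+1) (v * 'C(n + s * j, k * j) + w * 'C((n + s * j).-1, k * j))%:R.

(** Truncating at degree [n] loses nothing: for [j > n] and [s < k] the lower index [k * j] exceeds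
    [n + s * j]. *)
Lemma coef_binpoly (F : nzRingType) (s k v w n j : nat) : (s < k)%N ->
  (binpoly F s k v w n)`_j
    = (v * 'C(n + s * j, k * j) + w * 'C((n + s * j).-1, k * j))%:R.
Proof.
move=> sk; rewrite coef_poly ltnS; case: leqP => // nj.
have lt_bin : (n + s * j < k * j)%N by nia.
by rewrite !bin_small ?muln0 //; apply: leq_ltn_trans lt_bin; exact: leq_pred.
Qed.

Lemma horner_binpoly012 (F : comNzRingType) (s k v w : nat) (t : F) :
  [/\ (binpoly F s k v w 0).[t] = (v + w)%:R,
      (binpoly F s k v w 1).[t]
        = (v + w)%:R + (v * 'C(1 + s, k) + w * 'C(s, k))%:R * t
    & (binpoly F s k v w 2).[t]
        = (v + w)%:R + (v * 'C(2 + s, k) + w * 'C(s.+1, k))%:R * t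
          + (v * 'C(2 + s * 2, k * 2) + w * 'C((s * 2).+1, k * 2))%:R * t ^+ 2].
Proof.
by split; rewrite horner_poly !big_ord_recr big_ord0 /= !muln0 !bin0 ?muln1
  ?(expr0, expr1, add0r, mulr1, muln1).
Qed.

(** By Pascal's rule a second difference in the upper index lowers the lower index by 2, and
    [n + s * j.+1] equals [(n + s) + s * j], the upper index in the previous coefficient at
    [n + s]. *)
Lemma binpoly2_rec (F : comNzRingType) (s v w n : nat) : (0 < s < 2)%N ->
  binpoly F s 2 v w n.+2 = 2 *: binpoly F s 2 v w n.+1 - binpoly F s 2 v w n
    + 'X * binpoly F s 2 v w (n + s).
Proof.
move=> /andP[s_gt0 s_lt]; apply/polyP => j.
rewrite !coefD coefN coefZ coefXM !coef_binpoly //.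
case: j => [|j] /=; first by rewrite !muln0 !bin0; ring.
(* Positivity of [s] makes the upper index a successor, so [.-1] is a true predecessor and Pascal's
   rule applies to both terms. *)
have [m nE] : exists m, (n + s * j.+1 = m.+1)%N by exists (n + s * j.+1).-1; nia.
have -> : (n.+1 + s * j.+1 = m.+2)%N by lia.
have -> : (n.+2 + s * j.+1 = m.+3)%N by lia.
have -> : (n + s + s * j = m.+1)%N by lia.
by rewrite nE (_ : 2 * j.+1 = (2 * j).+2)%N /=;
  [rewrite !binS !mulnDr !natrD; ring | lia].
Qed.

Lemma binpoly3_rec (F : comNzRingType) (s v w n : nat) : (0 < s < 3)%N ->
  binpoly F s 3 v w n.+3
    = 3 *: binpoly F s 3 v w n.+2 - 3 *: binpoly F s 3 v w n.+1
      + binpoly F s 3 v w n + 'X * binpoly F s 3 v w (n + s).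
Proof.
move=> /andP[s_gt0 s_lt]; apply/polyP => j.
rewrite !coefD coefN !coefZ coefXM !coef_binpoly //.
case: j => [|j] /=; first by rewrite !muln0 !bin0; ring.
have [m nE] : exists m, (n + s * j.+1 = m.+1)%N by exists (n + s * j.+1).-1; nia.
have -> : (n.+1 + s * j.+1 = m.+2)%N by lia.
have -> : (n.+2 + s * j.+1 = m.+3)%N by lia.
have -> : (n.+3 + s * j.+1 = m.+4)%N by lia.
have -> : (n + s + s * j = m.+1)%N by lia.
by rewrite nE (_ : 3 * j.+1 = (3 * j).+3)%N /=;
  [rewrite !binS !mulnDr !natrD; ring | lia].
Qed.

(** As [s < 3], the index [n + s] lies below [n.+3], so the recurrence and three initial values
    determine the sequence. *)
Lemma horner_binpoly3_unique (F : comNzRingType) (s v w : nat) (f : nat -> F) (t : F) :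
  (0 < s < 3)%N ->
  (forall n, f n.+3 = 3 * f n.+2 - 3 * f n.+1 + f n + t * f (n + s)%N) ->
  (forall n, (n < 3)%N -> (binpoly F s 3 v w n).[t] = f n) ->
  forall n, (binpoly F s 3 v w n).[t] = f n.
Proof.
move=> sP frec f0 n; elim/ltn_ind: n => -[|[|[|n]]] IH; try exact: f0.
rewrite binpoly3_rec // !hornerE frec !IH //; lia.
Qed.

Lemma horner_binpoly2_unique (F : comNzRingType) (s v w : nat) (f : nat -> F) (t : F) :
  (0 < s < 2)%N ->
  (forall n, f n.+2 = 2 * f n.+1 - f n + t * f (n + s)%N) ->
  (forall n, (n < 2)%N -> (binpoly F s 2 v w n).[t] = f n) ->
  forall n, (binpoly F s 2 v w n).[t] = f n.
Proof.
move=> sP frec f0 n; elim/ltn_ind: n => -[|[|n]] IH; try exact: f0.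
rewrite binpoly2_rec // !hornerE frec !IH //; lia.
Qed.

(** * Closed forms of the norm polynomial for [k = 1, 2, 3] *)

Lemma horner_root_norm (F : fieldType) (n k : nat) (z t : F) :
  (root_norm n k z).[t]
    = \prod_(i < n) ((1 - z ^+ i) ^+ k + (z ^+ i) ^+ (k - 1) * t).
Proof.
rewrite horner_prod; apply: eq_bigr => i _.
by rewrite hornerD hornerC hornerZ hornerX -exprM mulnC.
Qed.

Lemma root_norm1 (F : numFieldType) (n : nat) (z : F) :
  n.-primitive_root z -> root_norm n 1 z = (1 + 'X) ^+ n - 1.
Proof.
move=> zP; apply: eq_poly_horner => t; rewrite horner_root_norm.
rewrite hornerD hornerN horner_exp hornerD hornerX !hornerC.
rewrite -(prod_prim_root_sub _ zP); apply: eq_bigr => i _.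
by rewrite subnn expr0 expr1 mul1r addrAC.
Qed.

(** Here [(1 - u)^2 + u t = (a - u)(b - u)] with [a + b = 2 - t] and [a b = 1], and the norm is
    [2 - (a^n + b^n)]. The recurrence carries [-t], hence the composition with [- 'X]. *)
Lemma root_norm2 (F : numClosedFieldType) (n : nat) (z : F) :
  n.-primitive_root z ->
  root_norm n 2 z = 2%:P - (binpoly F 1 2 1 1 n \Po - 'X).
Proof.
move=> zP; apply: eq_poly_horner => t; rewrite horner_root_norm.
have [a [b [ab_s ab_p]]] := closed_quadratic (2 - t) (1 : F).
under eq_bigr => i _.
  rewrite (_ : _ + _ = (a - z ^+ i) * (b - z ^+ i)).
    over.
  rewrite subn1 expr1 (_ : (a - _) * _ = a * b - (a + b) * z ^+ i + z ^+ i ^+ 2).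
    by rewrite ab_s ab_p; ring.
  by ring.
rewrite big_split /= !(prod_prim_root_sub _ zP) hornerD hornerN horner_comp.
rewrite hornerN hornerX ?hornerC.
rewrite (@horner_binpoly2_unique _ 1 1 1 (fun m => a ^+ m + b ^+ m)) //.
- rewrite (_ : _ * (b ^+ n - 1) = (a * b) ^+ n - a ^+ n - b ^+ n + 1);
    last by rewrite exprMn; ring.
  by rewrite ab_p expr1n; ring.
- have root2 x y : x + y = 2 - t -> x * y = 1 -> forall m,
      x ^+ m.+2 = 2 * x ^+ m.+1 - x ^+ m - t * x ^+ m.+1.
    (* Eliminating [t] and inserting [x * y = 1] next to [x ^+ m] turns the recurrence into a ring
       identity. *)
    move=> xy_s xy_p m; have -> : t = 2 - (x + y) by rewrite xy_s; ring.
    have -> : x ^+ m = x ^+ m * (x * y) by rewrite xy_p mulr1.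
    by rewrite !exprS; ring.
  move=> m; rewrite addn1 (root2 a b) // (root2 b a); first by ring.
    by rewrite addrC.
  by rewrite mulrC.
- have [B0 B1 _] := horner_binpoly012 1 2 1 1 (- t).
  case=> [|[|//]] _; first by rewrite B0 !expr0.
  by rewrite B1 (_ : (1 * _ + _ = 1)%N) // !expr1 ab_s; ring.
Qed.

(** Here [(1 - u)^3 + u^2 t = (a - u)(b - u)(c - u)] with elementary symmetric functions [3 + t],
    [3], [1]. Since [a b c = 1], the norm is the power sum of [a, b, c] minus that of
    [a b, b c, c a]. *)
Lemma root_norm3 (F : numClosedFieldType) (n : nat) (z : F) :
  n.-primitive_root z ->
  root_norm n 3 z = binpoly F 2 3 1 2 n - (binpoly F 1 3 2 1 n \Po - 'X).
Proof.
move=> zP; apply: eq_poly_horner => t; rewrite horner_root_norm.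
have [a [b [c [e1 e2 e3]]]] := closed_cubic (3 + t) 3 (1 : F).
under eq_bigr => i _.
  rewrite (_ : _ + _ = (a - z ^+ i) * (b - z ^+ i) * (c - z ^+ i)).
    over.
  rewrite (_ : _ * (c - _) = a * b * c - (a * b + b * c + a * c) * z ^+ i
     + (a + b + c) * z ^+ i ^+ 2 - z ^+ i ^+ 3).
    by rewrite e1 e2 e3 /=; ring.
  by ring.
rewrite !big_split /= !(prod_prim_root_sub _ zP) hornerD hornerN horner_comp.
rewrite hornerN hornerX ?hornerC.
have root3 x y w :
    x + y + w = 3 + t -> x * y + y * w + x * w = 3 -> x * y * w = 1 ->
    forall m,
      x ^+ m.+3 = 3 * x ^+ m.+2 - 3 * x ^+ m.+1 + x ^+ m + t * x ^+ m.+2.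
  move=> xs xe xp m; rewrite !exprS; set d := _ ^+ m.
  rewrite (_ : x * (x * (x * d)) = (x + y + w) * (x * (x * d))
     - (x * y + y * w + x * w) * (x * d) + x * y * w * d); last by ring.
  by rewrite xs xe xp; ring.
(* The pairwise products are the inverses of the roots, which swaps the symmetric functions to [3],
   [3 + t], [1]; the term in [t] changes sign and moves to index [m.+1]. *)
have root3' x y w :
    x + y + w = 3 + t -> x * y + y * w + x * w = 3 -> x * y * w = 1 ->
    forall m, (x * y) ^+ m.+3
      = 3 * (x * y) ^+ m.+2 - 3 * (x * y) ^+ m.+1 + (x * y) ^+ m
        - t * (x * y) ^+ m.+1.
  move=> xs xe xp m.
  rewrite !exprS; set d := _ ^+ m.
  rewrite (_ : x * y * (x * y * (x * y * d))
    = (x * y + y * w + x * w) * (x * y * (x * y * d))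
      - (x * y * w) * (x + y + w) * (x * y * d)
      + (x * y * w) * (x * y * w) * d); last by ring.
  by rewrite xs xe xp; ring.
have [f1 f2 f3] : [/\ b + c + a = 3 + t, b * c + c * a + b * a = 3 & b * c * a = 1].
  by split; rewrite -?e1 -?e2 -?e3; ring.
have [g1 g2 g3] : [/\ c + a + b = 3 + t, c * a + a * b + c * b = 3 & c * a * b = 1].
  by split; rewrite -?e1 -?e2 -?e3; ring.
rewrite (@horner_binpoly3_unique _ 2 1 2 (fun m => a ^+ m + b ^+ m + c ^+ m) t) //.
- rewrite (@horner_binpoly3_unique _ 1 2 1
    (fun m => (a * b) ^+ m + (b * c) ^+ m + (c * a) ^+ m)) //.
  + rewrite (_ : _ * (c ^+ n - 1)
      = (a * b * c) ^+ n - (a * b) ^+ n - (b * c) ^+ n - (c * a) ^+ n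
       + a ^+ n + b ^+ n + c ^+ n - 1); last by rewrite !exprMn; ring.
    by rewrite e3 expr1n; ring.
  + move=> m; rewrite addn1 (root3' a b c) // (root3' b c a) // (root3' c a b) //; ring.
  + have [B0 B1 B2] := horner_binpoly012 1 3 2 1 (- t).
    case=> [|[|[|//]]] _; first by rewrite B0 !expr0; ring.
      by rewrite B1 (_ : (2 * _ + _ = 0)%N) // !expr1 (mulrC c) e2; ring.
    rewrite B2 (_ : (2 * 'C(2 + 1, 3) + _ = 2)%N) // (_ : (2 * 'C(_, _) + _ = 0)%N) //.
    rewrite (_ : _ + (c * a) ^+ 2
        = (a * b + b * c + a * c) ^+ 2 - 2 * (a * b * c) * (a + b + c)); last by ring.
    by rewrite e1 e2 e3; ring.
- by move=> m; rewrite addn2 (root3 a b c) // (root3 b c a) // (root3 c a b) //; ring.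
- have [B0 B1 B2] := horner_binpoly012 2 3 1 2 t.
  case=> [|[|[|//]]] _; first by rewrite B0 !expr0; ring.
    by rewrite B1 (_ : (1 * _ + _ = 1)%N) // !expr1 e1; ring.
  rewrite B2 (_ : (1 * 'C(2 + 2, 3) + _ = 6)%N) // (_ : (1 * 'C(_, _) + _ = 1)%N) //.
  rewrite (_ : _ + c ^+ 2 = (a + b + c) ^+ 2 - 2 * (a * b + b * c + a * c)); last by ring.
  by rewrite e1 e2; ring.
Qed.

(** * Coefficients as single binomials, and conclusion *)

Lemma coef_1DX_exp (R : comNzRingType) (n j : nat) :
  ((1 + 'X) ^+ n : {poly R})`_j = 'C(n, j)%:R.
Proof.
rewrite exprDn coef_sum.
under eq_bigr => i _ do rewrite expr1n mul1r coefMn coefXn.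
have [jn|nj] := ltnP j n.+1; last first.
  rewrite bin_small // big1 // => i _.
  by rewrite gtn_eqF ?mul0rn // (leq_trans (ltn_ord i)).
rewrite (bigD1 (Ordinal jn)) //= eqxx big1 ?addr0 // => i ij.
by rewrite eq_sym (_ : (_ == _ :> nat) = false) ?mul0rn //; exact: negPf ij.
Qed.

(** Pascal's rule leaves ['C(n + r, 2 * r + 1)] and its right neighbour, which [mul_bin_left]
    eliminates. Treating the vanishing case apart keeps the subtraction in that identity exact. *)
Lemma mulS_coef_binpoly2 (n r : nat) :
  (r.+1 * (1 * 'C(n + 1 * r.+1, 2 * r.+1)
      + 1 * 'C((n + 1 * r.+1).-1, 2 * r.+1))
    = n * 'C(n + r, 2 * r + 1))%N.
Proof.
have -> : (n + 1 * r.+1 = (n + r).+1)%N by lia.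
have -> : (2 * r.+1 = (2 * r + 1).+1)%N by lia.
rewrite /= binS; have := mul_bin_left (n + r) (2 * r + 1).
have [lt_bin | le_bin] := ltnP (n + r) (2 * r + 1).
  by rewrite !bin_small ?muln0 // ltnS ltnW.
have [d nE] : exists d, n = (r.+1 + d)%N by exists (n - (r.+1))%N; lia.
rewrite (_ : n + r - (2 * r + 1) = d)%N; last by lia.
move: 'C(n + r, (2 * r + 1).+1) 'C(n + r, 2 * r + 1) => y x.
by rewrite nE => E; lia.
Qed.

Lemma mulS_coef_binpoly3 (n r : nat) :
  (r.+1 * (1 * 'C(n + 2 * r.+1, 3 * r.+1)
      + 2 * 'C((n + 2 * r.+1).-1, 3 * r.+1))
    = n * 'C(n + 2 * r + 1, 3 * r + 2))%N.
Proof.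
have -> : (n + 2 * r.+1 = (n + 2 * r + 1).+1)%N by lia.
have -> : (3 * r.+1 = (3 * r + 2).+1)%N by lia.
rewrite /= binS; have := mul_bin_left (n + 2 * r + 1) (3 * r + 2).
have [lt_bin | le_bin] := ltnP (n + 2 * r + 1) (3 * r + 2).
  by rewrite !bin_small ?muln0 // ltnS ltnW.
have [d nE] : exists d, n = (r.+1 + d)%N by exists (n - (r.+1))%N; lia.
rewrite (_ : n + 2 * r + 1 - (3 * r + 2) = d)%N; last by lia.
move: 'C(n + 2 * r + 1, (3 * r + 2).+1) 'C(n + 2 * r + 1, 3 * r + 2) => y x.
by rewrite nE => E; lia.
Qed.

Lemma mulS_coef_binpoly3' (n r : nat) :
  (r.+1 * (2 * 'C(n + 1 * r.+1, 3 * r.+1)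
      + 1 * 'C((n + 1 * r.+1).-1, 3 * r.+1))
    = n * 'C(n + r, 3 * r + 2))%N.
Proof.
have -> : (n + 1 * r.+1 = (n + r).+1)%N by lia.
have -> : (3 * r.+1 = (3 * r + 2).+1)%N by lia.
rewrite /= binS; have := mul_bin_left (n + r) (3 * r + 2).
have [lt_bin | le_bin] := ltnP (n + r) (3 * r + 2).
  by rewrite !bin_small ?muln0 // ltnS ltnW.
(* Here [d] is [n + r - (3 * r + 2)], the factor produced by [mul_bin_left]. *)
have [d nE] : exists d, n = ((2 * r).+2 + d)%N by exists (n - ((2 * r).+2))%N; lia.
rewrite (_ : n + r - (3 * r + 2) = d)%N; last by lia.
move: 'C(n + r, (3 * r + 2).+1) 'C(n + r, 3 * r + 2) => y x.
by rewrite nE => E; lia.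
Qed.

Theorem theorem1p1 (R : realType) (n : nat) (zeta : R[i])
    (n_ge1 : (1 <= n)%N) (zetaP : n.-primitive_root zeta) :
  (forall k r : nat, (1 <= k)%N -> (1 <= r)%N ->
     exists a : rat,
       zq n (nseq_tuple r k) zeta = (1 - zeta) ^+ (k * r) * ratr a)
  /\
  (forall r : nat, (1 <= r)%N ->
     [/\ zq n (nseq_tuple r 1%N) zeta
           = n%:R^-1 * 'C(n, r + 1)%:R * (1 - zeta) ^+ r,
         zq n (nseq_tuple r 2%N) zeta
           = (-1) ^+ r / (n * (r + 1))%:R * 'C(n + r, 2 * r + 1)%:R
             * (1 - zeta) ^+ (2 * r)
       & zq n (nseq_tuple r 3%N) zeta
           = (n ^ 2 * (r + 1))%:R^-1
             * ('C(n + 2 * r + 1, 3 * r + 2)%:R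
                + (-1) ^+ r * 'C(n + r, 3 * r + 2)%:R)
             * (1 - zeta) ^+ (3 * r)]).
Proof.
case: n => [//|n] in n_ge1 zetaP *.
have n_neq0 : n.+1%:R != 0 :> R[i] by rewrite pnatr_eq0.
split=> [k r k_gt0 _ | r _].
  have [p pE] := root_norm_rat k zetaP.
  exists (p`_r.+1 / n.+1%:R ^+ k).
  rewrite zq_root_norm // pE coef_map /= mulrC; congr (_ * _).
  by rewrite rmorphM fmorphV rmorphXn /= rmorph_nat.
have r_neq0 : r.+1%:R != 0 :> R[i] by rewrite pnatr_eq0.
have divS (u v : nat) : (r.+1 * u = n.+1 * v)%N ->
    u%:R = n.+1%:R * v%:R / r.+1%:R :> R[i].
  by move=> E; apply: (canRL (mulfK r_neq0)); rewrite -!natrM mulnC E.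
split; rewrite zq_root_norm //.
- rewrite root_norm1 // mul1n coefB coef_1DX_exp coef1 subr0 expr1 addn1.
  by rewrite [_ / _]mulrC.
(* The constant [2] does not reach the coefficient [r.+1], and the minus sign with [(-1) ^+ r.+1]
   from [- 'X] gives [(-1) ^+ r]. *)
- rewrite root_norm2 // coefB coefC sub0r coef_comp_polyN coef_binpoly //.
  rewrite (divS _ _ (mulS_coef_binpoly2 _ _)) addn1 natrM exprS.
  congr (_ * _); by field; rewrite ?natr1 ?nat1r ?r_neq0 ?n_neq0.
- rewrite root_norm3 // coefB coef_comp_polyN !coef_binpoly //.
  rewrite (divS _ _ (mulS_coef_binpoly3 _ _)) (divS _ _ (mulS_coef_binpoly3' _ _)).
  rewrite !addn1 natrM natrX exprS.
  congr (_ * _); by field; rewrite ?natr1 ?nat1r ?r_neq0 ?n_neq0.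
Qed.
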